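(* Let $\Gamma$ be a bipartite distance-regular graph with diameter $D\ge4$, eigenvalues $\theta_0>\theta_1>\dots>\theta_D$, and $d=\lfloor D/2\rfloor$. Let $\theta\in\mathbb{R}$ satisfy: if $D$ is odd, $\theta>\theta_1^2$ or $\theta<\theta_d^2$; if $D$ is even, $\theta>\theta_1^2$ or $\theta\le0$. (Then $P_i(\theta)\ne0$ for $0\le i\le D-1$.) For $0\le i\le D-2$ define $$g_i=\sum_{\substack{h=0\\ i-h\ \text{even}}}^{i}\frac{P_h(\theta)}{P_i(\theta)}\,\frac{k_ib_ib_{i+1}}{k_hb_hb_{h+1}}\,p_h\in\mathbb{R}[\lambda].$$ Then $g_0=1$ and $$\lambda g_i=c_{i+1}g_{i+1}+\omega_ig_{i-1}\qquad(0\le i\le D-2),$$ where $g_{-1}=0$, $\omega_0=0$, $g_{D-1}=p_{D-1}$, and $$\omega_i=\frac{b_{i+1}c_{i+2}}{c_i}\,\frac{P_{i-1}(\theta)P_{i+2}(\theta)}{P_i(\theta)P_{i+1}(\theta)}\qquad(1\le i\le D-2).$$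
   Context: $\Gamma$ is a finite connected bipartite distance-regular graph with intersection numbers $c_i,b_i$ ($c_0=0$, $b_D=0$) and $k_i=b_0b_1\cdots b_{i-1}/(c_1c_2\cdots c_i)$; $\theta_0>\dots>\theta_D$ are the distinct eigenvalues of its adjacency matrix. Polynomials in $\mathbb{R}[\lambda]$: $f_0=1$, $f_{-1}=0$, $\lambda f_i=b_{i-1}f_{i-1}+c_{i+1}f_{i+1}$ $(0\le i\le D-1)$; $p_i=f_i+f_{i-2}+f_{i-4}+\cdots$, ending with $f_0$ if $i$ is even and $f_1$ if $i$ is odd $(0\le i\le D)$. Each $p_i$ is even (resp. odd) when $i$ is even (resp. odd), and $P_i\in\mathbb{R}[\lambda]$ is defined by $p_i(\lambda)=P_i(\lambda^2)$ if $i$ is even and $p_i(\lambda)=\lambda P_i(\lambda^2)$ if $i$ is odd; $P_{-1}=0$. *)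

(* Defs.v *)
From HB Require Import structures.
From mathcomp Require Import all_boot all_order all_algebra.
From mathcomp Require Import reals.

Set Implicit Arguments.
Unset Strict Implicit.
Unset Printing Implicit Defensive.

Import Order.TTheory GRing.Theory Num.Theory.

Local Open Scope ring_scope.

Section Graphs.
Variables (V : finType) (e : rel V).

Definition simple_graph : Prop := symmetric e /\ irreflexive e.

Definition connected_graph : Prop := forall x y, connect e x y.

Definition bipartite_graph : Prop :=
  exists col : V -> bool, forall x y, e x y -> col x != col y.

Definition walk (x y : V) (n : nat) : bool :=
  [exists p : n.-tuple V, path e x p && (last x p == y)].

(* Length of a shortest walk from x to y.  The search is bounded because
   shortest walks have length less than #|V|; the value is #|V| when y is not
   reachable from x. *)
Definition dist (x y : V) : nat := find (walk x y) (iota 0 #|V|).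

Definition diameter : nat := \max_(x : V) \max_(y : V) dist x y.

(* In a graph of diameter D this forces c 0 = 0 and b D = 0, and it puts no
   constraint on c i and b i for i > D. *)
Definition intersection_numbers (c b : nat -> nat) : Prop :=
  forall x y : V,
    #|[set z | e y z & (dist x z).+1 == dist x y]| = c (dist x y) /\
    #|[set z | e y z & dist x z == (dist x y).+1]| = b (dist x y).

Definition distance_regular (c b : nat -> nat) : Prop :=
  [/\ simple_graph, connected_graph & intersection_numbers c b].

Definition adjmx (R : realType) : 'M[R]_#|V| :=
  \matrix_(i, j) (e (enum_val i) (enum_val j))%:R.

(* theta 0 > ... > theta D are all the eigenvalues of the adjacency matrix,
   without multiplicity. *)
Definition distinct_eigenvalues (R : realType) (D : nat)
    (theta : nat -> R) : Prop :=
  (forall i j : nat, (i < j <= D)%N -> theta j < theta i) /\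
  (forall x : R, eigenvalue (adjmx R) x <->
     exists2 i : nat, (i <= D)%N & x = theta i).

End Graphs.

Section Polynomials.
Variables (R : realType) (c b : nat -> nat).

Definition kval (i : nat) : R :=
  (\prod_(j < i) (b j)%:R) / (\prod_(j < i) (c j.+1)%:R).

(* The recurrence 'X f_i = b_(i-1) f_(i-1) + c_(i+1) f_(i+1), solved for
   f_(i+1), with f_(-1) = 0. *)
Fixpoint fpoly (i : nat) : {poly R} :=
  match i with
  | 0 => 1
  | j.+1 => (c j.+1)%:R^-1 *:
      ('X * fpoly j - match j with 0 => 0 | l.+1 => (b l)%:R *: fpoly l end)
  end.

Definition ppoly (i : nat) : {poly R} :=
  \sum_(h < i.+1 | ~~ odd (i - h)) fpoly h.

(* See Ppoly_spec for the characterization of this polynomial. *)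
Definition Ppoly (i : nat) : {poly R} :=
  if odd i then odd_poly (ppoly i) else even_poly (ppoly i).

(* The case i = D - 1 is separate because b_D = 0 makes the general formula
   read 0 / 0 there. *)
Definition gpoly (D : nat) (t : R) (i : nat) : {poly R} :=
  if i == D.-1 then ppoly i else
  \sum_(h < i.+1 | ~~ odd (i - h))
    ((Ppoly h).[t] / (Ppoly i).[t] *
     ((kval i * (b i)%:R * (b i.+1)%:R) / (kval h * (b h)%:R * (b h.+1)%:R)))
    *: ppoly h.

Definition omega (t : R) (i : nat) : R :=
  if i == 0%N then 0 else
  ((b i.+1)%:R * (c i.+2)%:R / (c i)%:R) *
  (((Ppoly i.-1).[t] * (Ppoly i.+2).[t]) / ((Ppoly i).[t] * (Ppoly i.+1).[t])).

Lemma fpoly_rec (i : nat) : (0 < c i.+1)%N ->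
  'X * fpoly i =
  (if i is l.+1 then (b l)%:R *: fpoly l else 0) + (c i.+1)%:R *: fpoly i.+1.
Proof.
move=> c_gt0; have c_neq0 : (c i.+1)%:R != 0 :> R by rewrite pnatr_eq0 -lt0n.
by case: i c_neq0 {c_gt0} => [|i] c_neq0 /=;
  rewrite scalerA divff // scale1r [RHS]addrC subrK.
Qed.

Lemma coef_fpoly_parity (i j : nat) : odd j != odd i -> (fpoly i)`_j = 0.
Proof.
have [n le_in] := ubnP i; elim: n => // n IHn in i j le_in *.
case: i le_in => [_|i le_in neq_ji]; first by rewrite /= coef1; case: j.
have shift : ('X * fpoly i)`_j = 0.
  rewrite coefXM; case: j neq_ji => //= j neq_ji.
  by apply: IHn => //; move: neq_ji; rewrite (inj_eq negb_inj).
have -> : fpoly i.+1 = (c i.+1)%:R^-1 *: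
  ('X * fpoly i - if i is l.+1 then (b l)%:R *: fpoly l else 0) by [].
rewrite coefZ coefB shift; case: i le_in neq_ji {shift} => [|i] le_in neq_ji.
  by rewrite coef0 subr0 mulr0.
rewrite coefZ IHn ?mulr0 ?subr0 ?mulr0 //; first exact: ltnW.
by move: neq_ji; rewrite /= negbK.
Qed.

Lemma coef_ppoly_parity (i j : nat) : odd j != odd i -> (ppoly i)`_j = 0.
Proof.
move=> neq_ji; rewrite coef_sum big1 // => h even_ih.
apply: coef_fpoly_parity; move: even_ih neq_ji.
by rewrite oddB -1?ltnS //; case: (odd i); case: (odd h).
Qed.

Lemma Ppoly_spec (i : nat) :
  ppoly i = if odd i then 'X * (Ppoly i \Po 'X^2) else Ppoly i \Po 'X^2.
Proof.
rewrite /Ppoly -[LHS]poly_even_odd; case: ifP => odd_i.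
  have -> : even_poly (ppoly i) = 0.
    apply/polyP => j; rewrite coef_even_poly coef0 coef_ppoly_parity //.
    by rewrite odd_double odd_i.
  by rewrite odd_i comp_poly0 add0r mulrC.
have -> : odd_poly (ppoly i) = 0.
  apply/polyP => j; rewrite coef_odd_poly coef0 coef_ppoly_parity //.
  by rewrite /= odd_double odd_i.
by rewrite odd_i comp_poly0 mul0r addr0.
Qed.

End Polynomials.

(* Main.v *)
(* Put [tau i = t] for [i] odd and [1] for [i] even.  Both [p_i] and
   [P_i := P_i(t)] satisfy three-term recurrences:
     [X p_i = c_(i+1) p_(i+1) + b_(i+1) p_(i-1)],
     [tau i P_i = c_(i+1) P_(i+1) + b_(i+1) P_(i-1)].
   Hence, with weights [w_h = k_h b_h b_(h+1)], the kernels
   [S_i = sum_(h <= i, h = i mod 2) P_h / w_h p_h] obey the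
   Christoffel-Darboux type identity
     [X S_i = P_i / (k_(i+1) b_(i+1)) p_(i+1) + tau (i+1) S_(i-1)],
   and [g_i = w_i / P_i S_i] turns it into the announced recurrence.

   For the non-vanishing of [P_i(t)]: the real roots of [p_(D-1)] are eigenvalues
   of the graph other than [theta_0], and a Sturm argument shows that if some
   [p_i] with [i < D] had a root beyond [theta_1], then so would [p_(D-1)].  For
   [t <= 0] the sign of [P_i(t)] is [(-1)^(i/2)] by the recurrence, and for [D]
   odd this persists on [(0, theta_d^2)] by the same Sturm argument applied to
   the [P_(2m)] from the other side, as no eigenvalue lies strictly between
   [- theta_d] and [theta_d]. *)

Require Import Defs.
From HB Require Import structures.
From mathcomp Require Import all_boot all_order all_algebra.
From mathcomp Require Import reals.
From mathcomp Require Import boolp zify ring lra.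

Set Implicit Arguments.
Unset Strict Implicit.
Unset Printing Implicit Defensive.

Import Order.TTheory GRing.Theory Num.Theory.

Local Open Scope ring_scope.

(** * Three-term recurrences and the kernel identity *)

(** The interface between the graph and the polynomial arguments. Constancy of [c i + b i] expresses
    regularity together with [a_i = 0], which bipartiteness forces; at [i = 0] it gives
    [c 0 = 0]. *)
Definition bipartite_array (D : nat) (c b : nat -> nat) : Prop :=
  [/\ forall i, (0 < i <= D)%N -> (0 < c i)%N,
      forall i, (i < D)%N -> (0 < b i)%N,
      b D = 0%N &
      forall i, (i <= D)%N -> (c i + b i = b 0)%N].

Lemma sum_same_parity_step (V : nmodType) (F : nat -> V) (i : nat) :
  \sum_(h < i.+3 | ~~ odd (i.+2 - h)) F h =
  \sum_(h < i.+1 | ~~ odd (i - h)) F h + F i.+2.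
Proof.
rewrite big_mkcond big_ord_recr big_ord_recr /= subnn subSn // subnn /= addr0.
congr (_ + _); rewrite [RHS]big_mkcond; apply: eq_bigr => h _ /=.
have lehi : (h <= i)%N by rewrite -ltnS.
by rewrite !subSn ?negbK // ltnW.
Qed.

Section Recurrences.
Variables (R : realType) (D : nat) (c b : nat -> nat).
Hypothesis cb : bipartite_array D c b.

Local Notation p := (ppoly R c b).
Local Notation P := (Ppoly R c b).
Local Notation f := (fpoly R c b).
Local Notation k := (kval R c b).

Lemma c_pos i : (i < D)%N -> 0 < (c i.+1)%:R :> R.
Proof. by case: cb => c0 _ _ _ ltiD; rewrite ltr0n c0. Qed.

Lemma b_pos i : (i < D)%N -> 0 < (b i)%:R :> R.
Proof. by case: cb => _ b0 _ _ ltiD; rewrite ltr0n b0. Qed.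

Lemma c_neq0 i : (i < D)%N -> (c i.+1)%:R != 0 :> R.
Proof. by move=> /c_pos /lt0r_neq0. Qed.

Lemma b_neq0 i : (i < D)%N -> (b i)%:R != 0 :> R.
Proof. by move=> /b_pos /lt0r_neq0. Qed.

Lemma cDb i : (i <= D)%N -> (c i)%:R + (b i)%:R = (b 0)%:R :> R.
Proof. by case: cb => _ _ _ cbk leiD; rewrite -natrD cbk. Qed.

Lemma ppolyS i : p i.+1 = (if i is j.+1 then p j else 0) + f i.+1.
Proof.
case: i => [|i]; last exact: sum_same_parity_step.
by rewrite /ppoly big_mkcond !big_ord_recl big_ord0 /= ?add0r ?addr0.
Qed.

Lemma ppoly0 : p 0 = 1.
Proof. by rewrite /ppoly big_mkcond big_ord_recl big_ord0 /= addr0. Qed.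

(** Induction in steps of two, adding the recurrence of [f i.+2] to that of [p i]. The coefficient
    of [p i.+1] becomes [c i.+1 + b i.+1 = b 0], which is split again as [c i.+3 + b i.+3]. *)
Lemma ppoly_rec i : (i < D)%N ->
  'X * p i = (c i.+1)%:R *: p i.+1 +
             (b i.+1)%:R *: (if i is j.+1 then p j else 0).
Proof.
elim/ltn_ind: i => -[|[|i]] IH ltiD.
- by rewrite ppolyS add0r scaler0 ppoly0 (@fpoly_rec _ c b 0) ?addr0 ?add0r //;
    case: cb => + _ _ _; apply.
- rewrite 2!ppolyS add0r fpoly_rec; last by case: cb => + _ _ _; apply.
  by rewrite ppoly0 -(cDb ltiD) scalerDr scalerDl addrAC.
rewrite ppolyS mulrDr IH // ?(ltn_trans _ ltiD) // fpoly_rec; last first.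
  by case: cb => + _ _ _; apply.
rewrite addrA -[_ + _ + _ *: f i.+1]addrA -scalerDr -ppolyS -scalerDl.
rewrite cDb ?(ltn_trans _ ltiD) // [p i.+3]ppolyS.
by rewrite -(cDb ltiD) scalerDr scalerDl addrAC.
Qed.

(** With [s = 'X^2], an odd [p i] times ['X] is [s P_i(s)], whereas for even [i] the factor ['X] is
    absorbed by the neighbours of odd index. *)
Lemma Ppoly_rec i : (i < D)%N ->
  (if odd i then 'X else 1) * P i =
  (c i.+1)%:R *: P i.+1 + (b i.+1)%:R *: (if i is j.+1 then P j else 0).
Proof.
move=> /ppoly_rec; case: i => [|i] E.
  rewrite mul1r scaler0 addr0 /Ppoly /= -odd_polyMX mulrC E.
  by rewrite scaler0 addr0 odd_polyZ.
rewrite /Ppoly /=; case: (odd i) => /=.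
  by rewrite mul1r -odd_polyMX mulrC E odd_polyD !odd_polyZ.
by rewrite -!even_polyZ -even_polyD -E mulrC -even_polyMX mulrC.
Qed.

Lemma Ppoly0 : P 0 = 1.
Proof. by rewrite /Ppoly ppoly0 even_polyC. Qed.

Lemma ppoly_horner i x : (p i).[x] = (if odd i then x else 1) * (P i).[x ^+ 2].
Proof.
rewrite Ppoly_spec; case: ifP => _.
  by rewrite hornerM hornerX horner_comp hornerXn.
by rewrite horner_comp hornerXn mul1r.
Qed.

(** * The kernel sums and the recurrence of the g_i *)

Section Kernel.
Variable t : R.
Hypothesis P_neq0 : forall i, (i < D)%N -> (P i).[t] != 0.

Local Notation w i := (k i * (b i)%:R * (b i.+1)%:R).
Local Notation tau i := (if odd i then t else 1).

Definition kernel_sum i : {poly R} :=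
  \sum_(h < i.+1 | ~~ odd (i - h)) ((P h).[t] / w h) *: p h.
Local Notation S := kernel_sum.

Lemma kvalS i : (i < D)%N -> k i.+1 = k i * (b i)%:R / (c i.+1)%:R.
Proof.
move=> ltiD; rewrite /kval !big_ord_recr /=; field.
rewrite c_neq0 //=; apply/prodf_neq0 => j _.
by rewrite c_neq0 // (ltn_trans _ ltiD).
Qed.

Lemma kval_neq0 i : (i <= D)%N -> k i != 0.
Proof.
move=> leiD; rewrite /kval mulf_neq0 ?invr_eq0 //; apply/prodf_neq0 => j _;
  by rewrite ?c_neq0 ?b_neq0 // (leq_trans _ leiD).
Qed.

Lemma Ppoly_horner_rec i : (i < D)%N ->
  tau i * (P i).[t] = (c i.+1)%:R * (P i.+1).[t] +
    (b i.+1)%:R * (if i is j.+1 then (P j).[t] else 0).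
Proof.
move=> /Ppoly_rec /(congr1 (fun q => q.[t])).
rewrite hornerM hornerD !hornerZ => E.
have -> : tau i = (if odd i then 'X else 1 : {poly R}).[t].
  by case: ifP; rewrite ?hornerX ?hornerC.
by rewrite E; case: i {E} => [|i]; rewrite ?horner0.
Qed.

Lemma kernel_sumS i : S i.+1 = (if i is j.+1 then S j else 0) +
  ((P i.+1).[t] / w i.+1) *: p i.+1.
Proof.
case: i => [|i].
  by rewrite /kernel_sum big_mkcond !big_ord_recl big_ord0 /= ?add0r ?addr0.
exact: (sum_same_parity_step (fun h => ((P h).[t] / w h) *: p h)).
Qed.

Lemma kernel_sum0 : S 0 = (w 0)^-1%:P.
Proof.
rewrite /kernel_sum big_mkcond big_ord_recl big_ord0 /= addr0.
by rewrite Ppoly0 ppoly0 hornerC mul1r alg_polyC.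
Qed.

Lemma christoffel_darboux i : (i.+1 < D)%N ->
  'X * S i = ((P i).[t] / (k i.+1 * (b i.+1)%:R)) *: p i.+1 +
    tau i.+1 *: (if i is j.+1 then S j else 0).
Proof.
elim/ltn_ind: i => -[|[|i]] IH ltiD.
- rewrite kernel_sum0 scaler0 addr0 Ppoly0 hornerC.
  have := ppoly_rec (ltnW ltiD); rewrite scaler0 addr0 ppoly0 mulr1 => ->.
  rewrite mulrC mul_polyC scalerA; congr (_ *: _).
  rewrite kvalS ?(ltnW ltiD) //; field.
  by rewrite kval_neq0 // !b_neq0 ?c_neq0 // ltnW.
- have lt1D := ltnW ltiD; have lt0D := ltnW lt1D.
  rewrite kernel_sumS add0r -scalerAr (ppoly_rec lt1D) kernel_sum0 ppoly0.
  rewrite scalerDr scale1r !scalerA; congr (_ + _).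
    congr (_ *: _); rewrite [k 2]kvalS //; field.
    by rewrite kval_neq0 ?b_neq0 ?c_neq0 // ltnW.
  rewrite alg_polyC; congr (_%:P).
  have := Ppoly_horner_rec lt0D; rewrite Ppoly0 hornerC mulr0 addr0 mul1r => E.
  have -> : (P 1).[t] = (c 1)%:R^-1.
    by apply: (mulfI (c_neq0 lt0D)); rewrite -E divff // c_neq0.
  rewrite kvalS //; field.
  by rewrite kval_neq0 ?b_neq0 ?c_neq0 // ltnW.
have lt2D := ltnW ltiD; have lt1D := ltnW lt2D; have lt0D := ltnW lt1D.
(* [e1] and [e2] treat the coefficients of [p i.+3] and [p i.+1] collected in ['X * S i.+2]. By the
   recurrence of the [P] at [i.+1], the second collapses to the coefficient of the top term of
   [tau i.+1 *: S i.+1]. *)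
have e1 : (P i.+2).[t] / w i.+2 * (c i.+3)%:R =
    (P i.+2).[t] / (k i.+3 * (b i.+3)%:R).
  rewrite [k i.+3]kvalS //; field.
  by rewrite kval_neq0 ?b_neq0 ?c_neq0 // ltnW.
have e2 : (P i).[t] / (k i.+1 * (b i.+1)%:R) +
    (P i.+2).[t] / w i.+2 * (b i.+3)%:R = tau i.+1 * ((P i.+1).[t] / w i.+1).
  rewrite mulrA Ppoly_horner_rec // [k i.+2]kvalS //; field.
  by rewrite kval_neq0 ?b_neq0 ?c_neq0 // ltnW.
rewrite kernel_sumS mulrDr IH // -scalerAr (ppoly_rec lt2D) kernel_sumS.
rewrite !scalerDr !scalerA e1 [odd i.+3]negbK -[odd i.+1]/(~~ odd i) -e2.
rewrite scalerDl addrACA [X in X + _ = _]addrC -!addrA; congr (_ + _).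
exact: addrCA.
Qed.

Lemma weight_neq0 i : (i.+1 < D)%N -> w i != 0.
Proof.
move=> ltSiD; have ltiD := ltnW ltSiD.
apply: mulf_neq0 (b_neq0 ltSiD); apply: mulf_neq0 (b_neq0 ltiD).
exact: kval_neq0 (ltnW ltiD).
Qed.

Lemma gpoly_kernel i : (i.+1 < D)%N ->
  gpoly c b D t i = (w i / (P i).[t]) *: S i.
Proof.
move=> ltSiD; rewrite /gpoly; case: eqP => [eqi|_].
  by move: ltSiD; rewrite eqi; case: (D) => [|?]; rewrite //= ltnn.
rewrite scaler_sumr; apply: eq_bigr => h _.
rewrite scalerA; congr (_ *: _); rewrite mulrACA [RHS]mulrACA.
by congr (_ * _); exact: mulrC.
Qed.

(* For [i = D - 1] the second summand vanishes because [b D = 0], in agreement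
   with the separate clause in the definition of [gpoly]. *)
Lemma gpolyS i : (i.+1 < D)%N ->
  gpoly c b D t i.+1 = p i.+1 +
    (w i.+1 / (P i.+1).[t]) *: (if i is j.+1 then S j else 0).
Proof.
move=> ltSiD; have [eqD|neqD] := eqVneq i.+2 D.
  have -> : b i.+2 = 0%N by rewrite eqD; case: cb.
  by rewrite mulr0 mul0r scale0r addr0 /gpoly -eqD eqxx.
have ltSSiD : (i.+2 < D)%N by rewrite ltn_neqAle neqD.
rewrite gpoly_kernel // kernel_sumS scalerDr addrC scalerA mulrA divfK ?P_neq0 //.
by rewrite divff ?scale1r // weight_neq0.
Qed.

Lemma gpoly0 : (1 < D)%N -> gpoly c b D t 0 = 1.
Proof.
move=> lt1D; rewrite gpoly_kernel // kernel_sum0 Ppoly0 hornerC divr1.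
by rewrite -mul_polyC -polyCM divff // weight_neq0.
Qed.

Lemma gpoly_rec i : (i.+1 < D)%N ->
  'X * gpoly c b D t i = (c i.+1)%:R *: gpoly c b D t i.+1 +
    omega c b t i *: (if i is j.+1 then gpoly c b D t j else 0).
Proof.
move=> ltSiD; have ltiD := ltnW ltSiD.
rewrite gpoly_kernel // gpolyS // -scalerAr christoffel_darboux //.
rewrite !scalerDr !scalerA -addrA; congr (_ + _).
  congr (_ *: _); rewrite kvalS //; field.
  by rewrite kval_neq0 ?P_neq0 ?b_neq0 ?c_neq0 // ltnW.
case: i => [|i] in ltSiD ltiD *; first by rewrite !scaler0 addr0.
rewrite gpoly_kernel // scalerA -scalerDl; congr (_ *: _).
(* Only the coefficients of [S i] are left to compare. Once [tau i.+2] is expanded by the recurrence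
   of the [P], the [P i.+1] part matches the contribution of [gpoly] at [i.+2] and the [P i.+3] part
   yields [omega]. *)
have -> : tau i.+2 = ((c i.+3)%:R * (P i.+3).[t] +
    (b i.+3)%:R * (P i.+1).[t]) / (P i.+2).[t].
  by rewrite -(Ppoly_horner_rec ltSiD) mulfK ?P_neq0.
rewrite /omega /= [k i.+2]kvalS // [k i.+1]kvalS ?(ltnW ltiD) //; field.
by rewrite ?P_neq0 ?c_neq0 // ltnW // ltnW.
Qed.

End Kernel.
End Recurrences.

(** * Largest roots *)

Section LargestRoot.
Variable R : realType.
Implicit Types (p : {poly R}) (x y z M : R).

(** Induction on the size: after division by ['X - x], either the quotient has a root in [(x, M]],
    from which the search continues, or [x] is already the largest root. *)
Lemma exists_largest_root p x M : p != 0 -> root p x -> x <= M ->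
  exists y, [/\ x <= y <= M, root p y & forall z, y < z <= M -> ~~ root p z].
Proof.
have [n] := ubnP (size p); elim: n => // n IHn in p x * => szp p0 px lexM.
have [q pE] := factor_theorem p x px.
have q0 : q != 0 by apply: contraNneq p0 => q0; rewrite pE q0 mul0r.
have [[x' [/andP[ltxx' lex'M] qx']]|noroot] :=
    pselect (exists x', x < x' <= M /\ root q x').
  have szq : (size q < n)%N.
    by move: szp; rewrite pE size_Mmonic ?monicXsubC // size_XsubC addn2.
  have [y [/andP[ley leyM] qy maxy]] := IHn q x' szq q0 qx' lex'M.
  exists y; split; first by rewrite leyM ltW // (lt_le_trans ltxx' ley).
    by rewrite pE rootM qy.
  move=> z /andP[ltyz lezM]; rewrite pE rootM negb_or maxy ?ltyz //.
  by rewrite root_XsubC gt_eqF // (lt_trans ltxx') // (le_lt_trans ley).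
exists x; split; rewrite ?lexx // => z ltxz.
rewrite pE rootM negb_or root_XsubC gt_eqF ?andbT; last by case/andP: ltxz.
by apply/negP => qz; apply: noroot; exists z.
Qed.

Lemma positive_above_largest_root p x M : x < M -> 0 < p.[M] -> p.[x] <= 0 ->
  exists y, [/\ x <= y < M, p.[y] = 0 & forall z, y < z <= M -> 0 < p.[z]].
Proof.
move=> ltxM pM px; have p0 : p != 0.
  by apply: contraTneq pM => ->; rewrite horner0 ltxx.
have ivt z : z <= M -> p.[z] <= 0 -> exists2 y, z <= y <= M & root p y.
  by move=> lezM pz; apply: poly_ivt => //; rewrite pz ltW.
have [x' /andP[lexx' lex'M] px'] := ivt x (ltW ltxM) px.
have [y [/andP[lex'y leyM] /rootP py maxy]] := exists_largest_root p0 px' lex'M.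
exists y; split=> //.
  rewrite (le_trans lexx' lex'y) lt_neqAle leyM andbT.
  by apply: contraTneq pM => <-; rewrite py ltxx.
move=> z /andP[ltyz lezM]; rewrite ltNge; apply/negP => pz.
have [w /andP[lezw lewM]] := ivt z lezM pz.
by apply/negP/maxy; rewrite lewM (lt_le_trans ltyz).
Qed.

(* A Sturm-type argument: where [q i] has its largest root below [M], [q i.+1]
   is negative, so that the largest roots increase with [i]. *)
Lemma root_persistence (q : nat -> {poly R}) (N : nat) x M :
  (forall i, (i <= N)%N -> 0 < (q i).[M]) ->
  (forall y, 0 < (q 0).[y]) ->
  (forall i y, (i.+1 < N)%N -> x <= y < M -> (q i.+1).[y] = 0 -> 0 < (q i).[y] ->
     (q i.+2).[y] < 0) ->
  x < M -> (forall y, x <= y < M -> (q N).[y] != 0) ->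
  forall i, (i <= N)%N -> 0 < (q i).[x].
Proof.
move=> qM q0 step ltxM qN.
(* Either no sign change has occurred on [[x, M)] up to index [i.+1], or [q i.+1] has a largest root
   there, at which [q i] is still positive. At [i.+1 = N] the second case contradicts the absence of
   roots of [q N]. *)
suff claim i : (i < N)%N ->
    (forall j y, (j <= i.+1)%N -> x <= y < M -> 0 < (q j).[y]) \/
    exists y, [/\ x <= y < M, (q i.+1).[y] = 0, 0 < (q i).[y] &
                 forall z, y < z <= M -> 0 < (q i.+1).[z]].
  case: N => [|n] in qM step qN claim * => i lein.
    by move: lein; rewrite leqn0 => /eqP->; exact: q0.
  have [//|pos|[y [xyM /eqP]]] := claim n; first by apply: pos; rewrite ?lexx.
  by rewrite (negPf (qN _ xyM)).
have new_root j x' : (j <= N)%N -> x <= x' < M -> (q j).[x'] <= 0 ->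
    exists y, [/\ x' <= y < M, (q j).[y] = 0 &
                 forall z, y < z <= M -> 0 < (q j).[z]].
  move=> lejN /andP[_ ltx'M].
  by apply: positive_above_largest_root => //; apply: qM.
elim: i => [|i IHi] ltiN.
  have [nonpos|pos] := pselect (exists y, x <= y < M /\ (q 1).[y] <= 0).
    have [x' [xx'M qx']] := nonpos.
    have [y [/andP[lex'y ltyM] qy posy]] := new_root 1%N x' ltiN xx'M qx'.
    right; exists y; split=> //; rewrite ltyM (le_trans _ lex'y) //.
    by case/andP: xx'M.
  left=> -[|[|j]] y // _ xyM; rewrite ltNge; apply/negP => qy.
  by apply: pos; exists y.
have [pos|[x' [xx'M qx' qix' posx']]] := IHi (ltnW ltiN).
  have [nonpos|pos'] := pselect (exists y, x <= y < M /\ (q i.+2).[y] <= 0).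
    have [x' [xx'M qx']] := nonpos.
    have [y [/andP[lex'y ltyM] qy posy]] := new_root i.+2 x' ltiN xx'M qx'.
    have xyM : x <= y < M.
      by rewrite ltyM (le_trans _ lex'y) //; case/andP: xx'M.
    by right; exists y; split=> //; apply: pos.
  left=> j y; rewrite leq_eqVlt => /predU1P[->|ltj] xyM; last exact: pos.
  by rewrite ltNge; apply/negP => qy; apply: pos'; exists y.
(* Negativity at [x'] forces a root of [q i.+2] strictly to the right of [x'], where [q i.+1] is
   positive because [x'] is its largest root. *)
have qlt0 := step i x' ltiN xx'M qx' qix'.
have [y [/andP[lex'y ltyM] qy posy]] :=
  new_root i.+2 x' ltiN xx'M (ltW qlt0).
have ltx'y : x' < y.
  rewrite lt_neqAle lex'y andbT.
  by apply: contraTneq qlt0 => ->; rewrite qy ltxx.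
right; exists y; split=> //; last by rewrite posx' // ltx'y ltW.
by rewrite ltyM (le_trans _ lex'y) //; case/andP: xx'M.
Qed.

End LargestRoot.

(** * Signs of the polynomials *)

Section Positivity.
Variables (R : realType) (D : nat) (c b : nat -> nat).
Hypothesis cb : bipartite_array D c b.

Local Notation p := (ppoly R c b).
Local Notation P := (Ppoly R c b).

Lemma ppoly_horner_rec i x : (i < D)%N ->
  x * (p i).[x] = (c i.+1)%:R * (p i.+1).[x] +
    (b i.+1)%:R * (if i is j.+1 then (p j).[x] else 0).
Proof.
move=> /(ppoly_rec R cb) /(congr1 (fun q => q.[x])).
by rewrite hornerM hornerX hornerD !hornerZ => ->; case: i => [|i];
  rewrite ?horner0.
Qed.

Lemma ppoly_gt0_large i x : (i <= D)%N -> (b 0)%:R <= x -> 0 < (p i).[x].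
Proof.
move=> leiD lekx.
(* The induction also carries monotonicity in the index: since [x] is at least
   [b 0 = c i.+1 + b i.+1], the bound [p i.-1 <= p i] at [x] gives [p i <= p i.+1]. *)
suff /(_ i leiD) [] : forall i, (i <= D)%N -> 0 < (p i).[x] /\
    (if i is j.+1 then (p j).[x] else 0) <= (p i).[x] by [].
elim=> [_|{leiD} {}i IHi ltiD]; first by rewrite ppoly0 hornerC.
have [pi lepi] := IHi (ltnW ltiD).
suff le : (p i).[x] <= (p i.+1).[x] by rewrite le (lt_le_trans pi).
have := ppoly_horner_rec x ltiD; set u := (if i is _.+1 then _ else _) in lepi *.
have := cDb R cb ltiD; have := c_pos R cb ltiD; have := ler0n R (b i.+1).
set C := (c i.+1)%:R; set B := (b i.+1)%:R => B0 C0 CB E.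
rewrite -(ler_pM2l C0); nra.
Qed.

(** Root persistence with [M] the valency. At a root of [p j.+1] the recurrence makes [p j.+2] a
    negative multiple of [p j]. *)
Lemma ppoly_gt0 i x : (0 < D)%N -> (i < D)%N ->
  (forall y, x <= y < (b 0)%:R -> (p D.-1).[y] != 0) -> 0 < (p i).[x].
Proof.
move=> D0 ltiD noroot; have [lekx|ltxk] := leP (b 0)%:R x.
  exact: ppoly_gt0_large (ltnW ltiD) lekx.
apply: (@root_persistence R p D.-1 x (b 0)%:R) => //.
- by move=> j lej; rewrite ppoly_gt0_large // (leq_trans lej) ?leq_pred.
- by move=> y; rewrite ppoly0 hornerC.
- move=> j y ltj _ qy q'y.
  have ltj' : (j.+1 < D)%N by rewrite (leq_trans ltj) // leq_pred.
  have ltj'' : (j.+2 < D)%N by move: ltj; case: (D).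
  have := ppoly_horner_rec y ltj'; rewrite qy mulr0 => E.
  have := c_pos R cb ltj'; have := b_pos R cb ltj''; nra.
- by rewrite -ltnS prednK.
Qed.

Lemma Ppoly_even_rec m t : (m.*2 < D)%N ->
  (P m.*2).[t] = (c m.*2.+1)%:R * (P m.*2.+1).[t] +
    (b m.*2.+1)%:R * (if m is n.+1 then (P n.*2.+1).[t] else 0).
Proof.
move=> /(Ppoly_horner_rec cb t); rewrite odd_double mul1r => ->.
by case: m.
Qed.

Lemma Ppoly_odd_rec m t : (m.*2.+1 < D)%N ->
  t * (P m.*2.+1).[t] = (c m.*2.+2)%:R * (P m.*2.+2).[t] +
    (b m.*2.+2)%:R * (P m.*2).[t].
Proof. by move=> /(Ppoly_horner_rec cb t); rewrite /= odd_double. Qed.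

(** The recurrence at even indices does not involve [t]: multiplied by [(-1) ^+ n], it makes the
    term of index [n.*2.+1] a sum of a positive and a nonnegative term. *)
Lemma Ppoly_odd_sign n t : (n.*2.+1 < D)%N ->
  (forall m, (m <= n)%N -> 0 < (-1) ^+ m * (P m.*2).[t]) ->
  0 < (-1) ^+ n * (P n.*2.+1).[t].
Proof.
elim: n => [|n IHn] ltnD pos.
  have := pos 0%N isT; have := Ppoly_even_rec t (ltnW ltnD).
  have := c_pos R cb (ltnW ltnD); rewrite !expr0 /= => c0 ->; nra.
have ltnD' : (n.*2.+1 < D)%N by rewrite ltnW // ltnW.
have := IHn ltnD' (fun m lemn => pos m (leqW lemn)).
have := pos n.+1 (leqnn _); have := Ppoly_even_rec t (ltnW ltnD).
have := c_pos R cb (ltnW ltnD); have := ler0n R (b n.+1.*2.+1).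
set C := (c _)%:R; set B := (b _)%:R; set z := _ ^+ n => B0 C0 E.
rewrite exprS -/z E; set u := _.[t]; set v := _.[t] => h1 h2.
rewrite -(pmulr_rgt0 _ C0); nra.
Qed.

Lemma Ppoly_neq0_of_even_sign i t : (i < D)%N ->
  (forall m, (m.*2 < D)%N -> 0 < (-1) ^+ m * (P m.*2).[t]) ->
  (P i).[t] != 0.
Proof.
move=> ltiD pos; suff : 0 < (-1) ^+ i./2 * (P i).[t].
  by move=> /lt0r_neq0; rewrite mulf_eq0 negb_or => /andP[].
rewrite -[i in P i]odd_double_half; case: (boolP (odd i)) => odd_i; last first.
  by apply: pos; move: ltiD; rewrite -{1}[i]odd_double_half (negPf odd_i).
have ltiD' : (i./2.*2.+1 < D)%N.
  by move: ltiD; rewrite -{1}[i]odd_double_half odd_i.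
apply: Ppoly_odd_sign => // m lem; apply: pos.
by rewrite (leq_ltn_trans _ (ltnW ltiD')) // leq_double.
Qed.

Lemma Ppoly_even_sign_nonpos m t : (m.*2 < D)%N -> t <= 0 ->
  0 < (-1) ^+ m * (P m.*2).[t].
Proof.
move=> ltmD t0; suff : forall n, (n.*2 < D)%N ->
    forall m, (m <= n)%N -> 0 < (-1) ^+ m * (P m.*2).[t].
  by move=> /(_ m ltmD m (leqnn m)).
elim=> [_ ? /[!leqn0] /eqP-> |n IHn ltnD j].
  by rewrite expr0 mul1r Ppoly0 hornerC.
rewrite doubleS in ltnD; have ltnD' := ltnW (ltnW ltnD).
rewrite leq_eqVlt => /predU1P[->|/(IHn ltnD')//].
have := Ppoly_odd_sign (ltnW ltnD) (IHn ltnD').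
have := IHn ltnD' n (leqnn n); have := Ppoly_odd_rec t (ltnW ltnD).
have := c_pos R cb (ltnW ltnD); have := b_pos R cb ltnD.
rewrite doubleS exprS; set C := (c _)%:R; set B := (b _)%:R; set z := _ ^+ n.
set u := (P _.+1).[t]; set v := (P _).[t]; set w := (P _).[t].
move=> B0 C0 E h1 h2; rewrite -(pmulr_rgt0 _ C0).
have -> : C * (-1 * z * v) = B * (z * w) - t * (z * u) by ring: E.
nra.
Qed.

(** The reflection [y -> - y] turns smallest positive roots into largest negative ones, so root
    persistence applies on [[- t, 0)]; at 0 the signs are those found for nonpositive arguments. *)
Lemma Ppoly_even_sign_small n t : D = n.*2.+1 -> 0 < t ->
  (forall y, 0 < y <= t -> (P n.*2).[y] != 0) ->
  forall m, (m.*2 < D)%N -> 0 < (-1) ^+ m * (P m.*2).[t].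
Proof.
move=> DE t0 noroot m ltmD.
pose q j := (-1) ^+ j *: (P j.*2 \Po (- 'X)).
have qE j y : (q j).[y] = (-1) ^+ j * (P j.*2).[- y].
  by rewrite hornerZ horner_comp hornerN hornerX.
have lemn : (m <= n)%N by rewrite -leq_double -ltnS -DE.
rewrite -[t]opprK -qE; apply: (@root_persistence R q n (- t) 0) => //.
- move=> j lejn; rewrite qE oppr0 Ppoly_even_sign_nonpos //.
  by rewrite DE ltnS leq_double.
- by move=> y; rewrite qE Ppoly0 hornerC expr0 mulr1.
- move=> j y ltj /andP[ley lty0]; rewrite !qE; move: ltj.
  rewrite -ltn_double -ltnS -DE !doubleS => ltj.
  have ltj1 := ltnW ltj; have ltj2 := ltnW ltj1.
  have /= := @Ppoly_odd_rec j.+1 (- y) ltj.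
  have /= := @Ppoly_odd_rec j (- y) ltj2.
  have /= := @Ppoly_even_rec j.+1 (- y) ltj1.
  have := c_pos R cb ltj1; have := c_pos R cb ltj.
  have := b_pos R cb ltj1; have := b_pos R cb ltj.
  rewrite !doubleS !exprS; set z := _ ^+ j; set u := (P _).[_].
  set C1 := (c _)%:R; set C2 := (c _)%:R; set B1 := (b _)%:R; set B2 := (b _)%:R.
  set w4 := (P j.*2.+4).[_]; set w3 := (P j.*2.+3).[_].
  set w1 := (P j.*2.+1).[_]; set w0 := (P j.*2).[_].
  move=> B1_gt0 B2_gt0 C1_gt0 C2_gt0 E2 E1 E3 /eqP.
  rewrite -mulrA mulN1r oppr_eq0 mulf_eq0 signr_eq0 /= => /eqP u0 zw0.
  rewrite u0 in E1 E2 E3.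
  (* At a root of the polynomial of index [j.+1.*2], eliminating the two odd-index values relates
     its even neighbours with opposite signs. *)
  have E : C1 * C2 * w4 = - (B1 * B2 * w0).
    rewrite mulr0 add0r in E1; rewrite mulr0 addr0 in E3.
    rewrite -[B1 * _ * _]mulrA -E1 mulrAC -E3; apply/eqP.
    rewrite -subr_eq0; set y' := - y.
    have -> : y' * w3 * C2 - - (B1 * (y' * w1)) = y' * (C2 * w3 + B1 * w1) by ring.
    by rewrite -E2 mulr0.
  have -> : -1 * (-1 * z) * w4 = z * w4 by ring.
  rewrite -(pmulr_rlt0 _ (mulr_gt0 C1_gt0 C2_gt0)) mulrCA E.
  by rewrite mulrN oppr_lt0 mulrCA (mulr_gt0 (mulr_gt0 B1_gt0 B2_gt0) zw0).
- by rewrite oppr_lt0.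
- move=> y /andP[ley lty]; rewrite qE mulf_neq0 ?signr_eq0 //.
  by apply: noroot; rewrite oppr_gt0 lty lerNl.
Qed.
End Positivity.

(** * Distances and eigenvalues in the graph *)

Section Distance.
Variables (V : finType) (e : rel V).

Lemma walkP x y n :
  reflect (exists p, [/\ size p = n, path e x p & last x p = y]) (walk e x y n).
Proof.
apply: (iffP existsP) => [[p /andP[xp /eqP lastp]]|[p [szp xp lastp]]].
  by exists p; rewrite size_tuple.
by exists (tcast szp (in_tuple p)); rewrite val_tcast xp lastp /=.
Qed.

Lemma dist_le x y n : walk e x y n -> (dist e x y <= n)%N.
Proof.
move=> xy; rewrite leqNgt; apply/negP => ltn; have := before_find 0%N ltn.
have ltnV : (n < #|V|)%N.
  by rewrite (leq_trans ltn) // -[#|V|](size_iota 0) find_size.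
by rewrite nth_iota // add0n xy.
Qed.

Hypothesis conn_e : connected_graph e.

(** A path without repeated vertices has length below [#|V|], so the bounded search in [dist]
    succeeds. *)
Lemma dist_walk x y : walk e x y (dist e x y).
Proof.
have /connectP[p xp ->] := conn_e x y; case/shortenP: xp => q xq uq _.
have has_walk : has (walk e x (last x q)) (iota 0 #|V|).
  apply/hasP; exists (size q); last by apply/walkP; exists q.
  rewrite mem_iota /= add0n -[(size q).+1]/(size (x :: q)) -(card_uniqP uq).
  exact: max_card.
have := nth_find 0%N has_walk; rewrite nth_iota //.
by move: has_walk; rewrite has_find size_iota.
Qed.

Lemma distxx x : dist e x x = 0%N.
Proof. by apply/eqP; rewrite -leqn0; apply/dist_le/walkP; exists [::]. Qed.

Lemma dist_edge x y z : e y z -> (dist e x z <= (dist e x y).+1)%N.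
Proof.
move=> yz; have /walkP[p [szp xp lastp]] := dist_walk x y.
apply/dist_le/walkP; exists (rcons p z).
by rewrite size_rcons szp rcons_path xp lastp yz last_rcons.
Qed.

Lemma dist_pred x y n : dist e x y = n.+1 -> exists2 z, e z y & dist e x z = n.
Proof.
move=> dxy; have /walkP[p [szp xp lastp]] := dist_walk x y.
move: szp xp lastp; case/lastP: p => [|p y']; first by rewrite dxy.
rewrite size_rcons rcons_path last_rcons dxy => -[szp] /andP[xp zy'] eqy.
rewrite eqy in zy'; exists (last x p) => //; apply/eqP; rewrite eqn_leq.
apply/andP; split; last by rewrite -ltnS -dxy dist_edge.
by rewrite -szp; apply/dist_le/walkP; exists p.
Qed.

Lemma exists_dist x y i : (i <= dist e x y)%N -> exists z, dist e x z = i.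
Proof.
move=> lei; rewrite -(subKn lei); move: (_ - i)%N => j {lei}.
elim: j => [|j [z dz]]; first by exists y; rewrite subn0.
case E: (dist e x y - j)%N => [|n]; first by exists z; rewrite dz subnS E.
by have [w _ dw] := dist_pred (etrans dz E); exists w; rewrite subnS E.
Qed.

Lemma diameter_attained (x0 : V) : exists x y, dist e x y = diameter e.
Proof.
have V0 : (0 < #|V|)%N by apply/card_gt0P; exists x0.
have [x xP] := bigop.eq_bigmax (fun x => \max_y dist e x y) V0.
have [y yP] := bigop.eq_bigmax (dist e x) V0.
by exists x, y; rewrite /diameter xP yP.
Qed.

Lemma dist_le_diameter x y : (dist e x y <= diameter e)%N.
Proof.
rewrite /diameter (leq_trans (leq_bigmax_cond (F := dist e x) y isT)) //.
exact: (leq_bigmax_cond (F := fun x => \max_y dist e x y)).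
Qed.

Hypothesis bip_e : bipartite_graph e.
Hypothesis sym_e : symmetric e.

(** The parity of the distance from [x] is determined by the colouring, so adjacent vertices cannot
    be equidistant from [x]. *)
Lemma dist_edge_cases x y z : e y z ->
  dist e x z = (dist e x y).+1 \/ (dist e x z).+1 = dist e x y.
Proof.
move=> yz; have [col colP] := bip_e.
have parity v : col x (+) col v = odd (dist e x v).
  have /walkP[p [<- xp <-]] := dist_walk x v.
  elim: p x xp => [|u p IHp] w /=; first by rewrite addbb.
  move=> /andP[/colP wu /IHp <-].
  by rewrite -addNb; congr (_ (+) _); case: (col w) (col u) wu => [] [].
have neq : dist e x y != dist e x z.
  apply: contraTneq (colP _ _ yz) => /(congr1 odd).
  by rewrite -!parity => /addbI ->; rewrite negbK eqxx.
have := dist_edge x yz; have := dist_edge x (etrans (sym_e z y) yz).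
lia.
Qed.

End Distance.

(** * The intersection array of the graph *)

Section Graph.
Variables (V : finType) (e : rel V) (c b : nat -> nat) (D : nat).
Hypotheses (drg_e : distance_regular e c b) (bip_e : bipartite_graph e).
Hypotheses (diam_e : diameter e = D) (D_gt0 : (0 < D)%N).

Lemma graph_nonempty : (0 < #|V|)%N.
Proof.
rewrite lt0n; apply/eqP => V0; move: D_gt0.
rewrite -diam_e /diameter big1 // => x _.
by have := card0_eq V0 x.
Qed.

(** Summing over neighbours maps a function of the distance from [x] to another such function;
    bipartiteness removes the middle term. *)
Lemma dist_sum (R : pzSemiRingType) (g : nat -> R) x y :
  \sum_(z | e z y) g (dist e x z) =
  (c (dist e x y))%:R * g (dist e x y).-1 +
  (b (dist e x y))%:R * g (dist e x y).+1.
Proof.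
have [[sym_e _] conn_e num] := drg_e; have [<- <-] := num x y.
rewrite (bigID (fun z => (dist e x z).+1 == dist e x y)) /=; congr (_ + _).
  rewrite mulr_natl -sumr_const; apply: eq_big => z; first by rewrite inE sym_e.
  by move=> /andP[_ /eqP <-].
rewrite mulr_natl -sumr_const; apply: eq_big => z; last first.
  move=> /andP[zy neq]; congr g.
  case: (dist_edge_cases conn_e bip_e sym_e x (etrans (sym_e y z) zy)) => // E.
  by rewrite E eqxx in neq.
rewrite inE [e y z]sym_e; case zy: (e z y) => //=.
case: (dist_edge_cases conn_e bip_e sym_e x (etrans (sym_e y z) zy)) => E.
  by rewrite E eqxx; lia.
by rewrite -E eqxx; lia.
Qed.

Lemma drg_bipartite_array : bipartite_array D c b.
Proof.
have [[sym_e _] conn_e num] := drg_e.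
have /card_gt0P[x0 _] := graph_nonempty.
have [x [y dxy]] := diameter_attained e x0; rewrite diam_e in dxy.
have ex i : (i <= D)%N -> exists z, dist e x z = i.
  by rewrite -dxy; apply: exists_dist.
have c0 : c 0 = 0%N.
  have [+ _] := num x x; rewrite distxx => <-; apply: eq_card0 => z.
  by rewrite !inE andbF.
(* The degree of [z] is computed from an arbitrary base vertex [w]; the choice [w = z] identifies it
   with [b 0]. *)
have deg z w : (c (dist e w z) + b (dist e w z))%N = #|[pred v | e v z]|.
  have := dist_sum (fun=> 1 : nat) w z; rewrite !mulr1 !natn => E.
  by rewrite -sum1_card; apply: esym E.
split=> [i /andP[i_gt0 leiD]|i ltiD||i leiD].
- have [z dz] := ex i leiD; have [+ _] := num x z; rewrite dz => <-.
  case: i => // i in i_gt0 leiD dz *; have [w wz dw] := dist_pred conn_e dz.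
  by apply/card_gt0P; exists w; rewrite inE sym_e wz dw eqxx.
- have [z dz] := ex i.+1 ltiD; have [w wz dw] := dist_pred conn_e dz.
  have [_] := num x w; rewrite dw => <-.
  by apply/card_gt0P; exists z; rewrite inE wz dz eqxx.
- have [_] := num x y; rewrite dxy => <-; apply: eq_card0 => z; rewrite !inE.
  have := dist_le_diameter e x z; rewrite diam_e leqNgt => leD.
  by apply/negP => /andP[_ /eqP E]; rewrite E ltnSn in leD.
- have [z dz] := ex i leiD; by rewrite -dz deg -(deg z z) distxx c0.
Qed.

(** * Eigenvectors, and the roots of p_(D-1) *)

Section Spectrum.
Variable R : realType.

Lemma eigenvalue_adjmxP (x : R) :
  eigenvalue (adjmx e R) x <->
  exists u : V -> R, (exists y, u y != 0) /\
    forall y, \sum_(z | e z y) u z = x * u y.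
Proof.
have mulE (v : 'rV[R]_#|V|) y : (v *m adjmx e R) 0 y =
    \sum_(z | e z (enum_val y)) v 0 (enum_rank z).
  rewrite mxE [RHS]big_mkcond [LHS](reindex enum_rank) /=; last first.
    by apply: onW_bij; exact: enum_rank_bij.
  apply: eq_bigr => z _; rewrite mxE enum_rankK.
  by case: ifP => _; rewrite ?mulr1 ?mulr0.
split=> [/eigenvalueP[v vA v0]|[u [[y uy] uA]]].
  exists (fun z => v 0 (enum_rank z)); split.
    have [i vi] : exists i, v 0 i != 0.
      by apply/existsP; rewrite -negb_forall; apply: contraNN v0 => /forallP v0;
        apply/eqP/rowP => i; rewrite mxE; apply/eqP.
    by exists (enum_val i); rewrite enum_valK.
  by move=> y; rewrite -[y]enum_rankK -mulE vA mxE enum_rankK.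
apply/eigenvalueP; exists (\row_i u (enum_val i)).
  apply/rowP => i; rewrite mulE !mxE -uA.
  by apply: eq_bigr => z _; rewrite mxE enum_rankK.
by apply: contraNneq uy => /rowP/(_ (enum_rank y)); rewrite !mxE enum_rankK => ->.
Qed.

(** Changing the sign of an eigenvector on one colour class negates its eigenvalue. *)
Lemma eigenvalue_opp (x : R) :
  eigenvalue (adjmx e R) x -> eigenvalue (adjmx e R) (- x).
Proof.
have [col colP] := bip_e.
move=> /eigenvalue_adjmxP[u [[y uy] uA]]; apply/eigenvalue_adjmxP.
exists (fun z => (-1) ^+ col z * u z); split.
  by exists y; rewrite mulf_neq0 ?signr_eq0.
move=> z; rewrite mulrCA mulNr -uA mulrN -mulNr mulr_sumr; apply: eq_bigr => w wz.
by congr (_ * _); move: (colP _ _ wz); case: (col w) (col z) => [] [] //;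
  rewrite ?expr0 ?expr1 ?opprK.
Qed.

Lemma eigenvalue_dist (u : nat -> R) (x : R) : u 0%N != 0 ->
  (forall i, (i <= D)%N -> (c i)%:R * u i.-1 + (b i)%:R * u i.+1 = x * u i) ->
  eigenvalue (adjmx e R) x.
Proof.
move=> u0 uA; have /card_gt0P[x0 _] := graph_nonempty; apply/eigenvalue_adjmxP.
exists (fun z => u (dist e x0 z)); split; first by exists x0; rewrite distxx.
by move=> y; rewrite dist_sum uA // -diam_e dist_le_diameter.
Qed.

Lemma eigenvalue_valency : eigenvalue (adjmx e R) (b 0)%:R.
Proof.
apply: (@eigenvalue_dist (fun=> 1)) => [|i leiD]; first exact: oner_neq0.
by rewrite !mulr1; apply: (cDb R drg_bipartite_array).
Qed.

(** The eigenvector has value [f i / k i] at distance [i] from a base vertex, an unnormalized cosine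
    sequence. The recurrence of the [f i] settles all distances below [D]; the root condition
    settles distance [D]. *)
Lemma eigenvalue_root_ppoly (x : R) :
  root (ppoly R c b D.-1) x -> eigenvalue (adjmx e R) x.
Proof.
have cb := drg_bipartite_array.
have kS := kvalS R cb.
move=> /rootP pD1; have pD : (ppoly R c b D).[x] = 0.
  have ltD1 : (D.-1 < D)%N by rewrite prednK.
  have := ppoly_horner_rec cb x ltD1.
  rewrite pD1 mulr0 prednK //; have [_ _ -> _] := cb.
  rewrite mul0r addr0 => /esym/eqP; rewrite mulf_eq0.
  have := c_neq0 R cb ltD1; rewrite prednK // => /negPf -> /= /eqP.
  exact.
pose f j := (fpoly R c b j).[x].
have f_rec j : (j < D)%N -> x * f j =
    (if j is l.+1 then (b l)%:R * f l else 0) + (c j.+1)%:R * f j.+1.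
  move=> ltjD; have [c_gt0 _ _ _] := cb.
  have := congr1 (fun q : {poly R} => q.[x])
    (@fpoly_rec R c b j (c_gt0 j.+1 ltjD)).
  rewrite hornerM hornerX hornerD hornerZ /f => ->.
  by case: (j) => [|l]; rewrite ?horner0 ?hornerZ.
(* Since [p D] and [p D.-1] vanish at [x], the values of [f D] and [f D.-1] are those of
   [- p (D - 2)] and [- p (D - 3)], related by the recurrence of the [p i] at [D - 2]. *)
have f_last : x * f D = (b D.-1)%:R * f D.-1.
  have fE j : f j.+1 = (ppoly R c b j.+1).[x] -
      (if j is l.+1 then (ppoly R c b l).[x] else 0).
    rewrite ppolyS hornerD /f; case: (j) => [|l].
      by rewrite horner0 subr0 add0r.
    by rewrite addrAC subrr add0r.
  case: (D) D_gt0 pD1 pD cb fE => // -[|n] _ pD1 pD cb' fE.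
    by move: pD1; rewrite ppoly0 hornerC => /eqP; rewrite oner_eq0.
  rewrite !fE pD pD1 !sub0r !mulrN (ppoly_horner_rec cb' x (ltnW (ltnSn _))).
  by rewrite pD1 mulr0 add0r.
apply: (@eigenvalue_dist (fun i => f i / kval R c b i)) => [|i].
  by rewrite /f hornerC mulf_neq0 ?oner_neq0 // invr_eq0 (kval_neq0 R cb).
rewrite leq_eqVlt => /predU1P[->|ltiD].
  have [_ _ -> _] := cb; rewrite mul0r addr0 [x * _]mulrA f_last.
  case: (D) D_gt0 kS cb => // D' _ kS cb /=; rewrite kS //; field.
  by rewrite (c_neq0 R cb) ?(b_neq0 R cb) ?(kval_neq0 R cb).
rewrite [x * _]mulrA f_rec // kS //.
case: i => [|i] in ltiD *.
  have -> : c 0 = 0%N by have [_ _ _ /(_ 0%N isT)] := cb; lia.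
  rewrite mul0r !add0r; field.
  by rewrite (c_neq0 R cb) ?(b_neq0 R cb) ?(kval_neq0 R cb).
rewrite [kval R c b i.+1]kS ?(ltnW ltiD) //=; field.
by rewrite !(c_neq0 R cb) ?(b_neq0 R cb) ?(kval_neq0 R cb) // ltnW // ltnW.
Qed.

End Spectrum.
End Graph.

(** * Order and symmetry of the spectrum *)

Section OrderedSpectrum.
Variables (R : realType) (V : finType) (e : rel V) (D : nat) (theta : nat -> R).
Hypothesis eig_e : distinct_eigenvalues e D theta.

Lemma distinct_eigenvalues_le i j : (i <= j <= D)%N -> theta j <= theta i.
Proof.
case/andP; rewrite leq_eqVlt => /predU1P[-> //|ltij lejD].
by rewrite ltW //; apply: eig_e.1; rewrite ltij.
Qed.

(** Reversing and negating the list of eigenvalues gives another strictly decreasing list of the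
    same set, hence the same list. *)
Lemma distinct_eigenvalues_opp j : bipartite_graph e -> (j <= D)%N ->
  theta (D - j) = - theta j.
Proof.
move=> bip_e lejD; have [dec eigP] := eig_e.
have mem_spec x : reflect (eigenvalue (adjmx e R) x) (x \in mkseq theta D.+1).
  apply: (iffP mapP) => [[i]|/eigP[i leiD ->]]; last first.
    by exists i; rewrite // mem_iota.
  by rewrite mem_iota add0n ltnS => leiD ->; apply/eigP; exists i.
suff /(congr1 (fun s => nth 0 s j)) :
    mkseq (fun i => - theta (D - i)) D.+1 = mkseq theta D.+1.
  by rewrite !nth_mkseq // => <-; rewrite opprK.
apply: (@irr_sorted_eq _ (fun x y : R => y < x)).
- by move=> y x z ltyx ltzy; apply: lt_trans ltyx.
- by move=> x; apply: ltxx.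
- apply/(sortedP 0) => i; rewrite size_mkseq => ltiD.
  by rewrite !nth_mkseq ?ltrN2 //; [apply: dec; lia|exact: ltnW].
- apply/(sortedP 0) => i; rewrite size_mkseq => ltiD.
  by rewrite !nth_mkseq //; [apply: dec; lia|exact: ltnW].
move=> x; apply/mapP/mem_spec => [[i]|eigx].
  rewrite mem_iota add0n ltnS => leiD ->; apply: eigenvalue_opp => //.
  by apply/eigP; exists (D - i)%N; rewrite ?leq_subr.
have /eigP[i leiD Ei] := eigenvalue_opp bip_e eigx.
exists (D - i)%N; first by rewrite mem_iota ltnS leq_subr.
by rewrite subKn // -Ei opprK.
Qed.

End OrderedSpectrum.

(** * Non-vanishing of P_i(t) in the admissible ranges of t *)

Section NonVanishing.
Variables (R : realType) (V : finType) (e : rel V) (c b : nat -> nat) (D : nat).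
Variables (theta : nat -> R) (t : R).
Hypotheses (drg_e : distance_regular e c b) (bip_e : bipartite_graph e).
Hypotheses (diam_e : diameter e = D) (D_gt0 : (0 < D)%N).
Hypothesis eig_e : distinct_eigenvalues e D theta.

Let cb := drg_bipartite_array drg_e bip_e diam_e D_gt0.

Lemma root_ppoly_theta x : (ppoly R c b D.-1).[x] = 0 ->
  exists2 j, (j <= D)%N & x = theta j.
Proof.
by move=> /rootP/(eigenvalue_root_ppoly drg_e bip_e diam_e D_gt0)/eig_e.2.
Qed.

Lemma Ppoly_neq0_large i : (i < D)%N -> theta 1%N ^+ 2 < t ->
  (Ppoly R c b i).[t] != 0.
Proof.
move=> ltiD lt1t; have t_gt0 : 0 < t := le_lt_trans (sqr_ge0 _) lt1t.
have lt1s : theta 1%N < Num.sqrt t.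
  by rewrite (le_lt_trans (ler_norm _)) // -sqrtr_sqr ltr_sqrt.
have /lt0r_neq0 : 0 < (ppoly R c b i).[Num.sqrt t].
  apply: (ppoly_gt0 cb) => // y /andP[ley lty]; apply/eqP => /root_ppoly_theta.
  (* The case [y = theta 0] is excluded because the valency is an eigenvalue, so [theta 0] is at
     least [b 0], while [y] lies below it. *)
  case=> -[|j] lejD yE.
    have /eig_e.2[j0 lej0 b0E] := eigenvalue_valency drg_e bip_e diam_e D_gt0 R.
    have := distinct_eigenvalues_le eig_e (lej0 : (0 <= j0 <= D)%N).
    by rewrite -yE -b0E leNgt lty.
  have := distinct_eigenvalues_le eig_e (lejD : (1 <= j.+1 <= D)%N).
  by rewrite -yE leNgt (lt_le_trans lt1s).
by rewrite ppoly_horner sqr_sqrtr ?ltW // mulf_eq0 negb_or => /andP[].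
Qed.

Lemma Ppoly_neq0_nonpos i : (i < D)%N -> t <= 0 -> (Ppoly R c b i).[t] != 0.
Proof.
move=> ltiD t0; apply: (Ppoly_neq0_of_even_sign cb) => // m ltmD.
exact: (Ppoly_even_sign_nonpos cb).
Qed.

(** A root [y] of [P D.-1] in [(0, t]] would make its square root an eigenvalue strictly between 0
    and [theta d], but [theta d] and [theta d.+1 = - theta d] are consecutive eigenvalues. *)
Lemma Ppoly_neq0_small i : (i < D)%N -> odd D -> t < theta D./2 ^+ 2 ->
  (Ppoly R c b i).[t] != 0.
Proof.
move=> ltiD oddD ltt; have [t0|t_gt0] := leP t 0; first exact: Ppoly_neq0_nonpos.
have DE : D = D./2.*2.+1 by rewrite -{1}[D]odd_double_half oddD.
set d := D./2 in ltt DE *.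
have opp_d : theta d.+1 = - theta d.
  by rewrite -(distinct_eigenvalues_opp eig_e) //; first congr theta; lia.
have d_gt0 : 0 < theta d.
  by have := eig_e.1 d d.+1; rewrite opp_d => /(_ ltac:(lia)); lra.
apply: (Ppoly_neq0_of_even_sign cb) => //.
apply: (Ppoly_even_sign_small cb DE t_gt0).
move=> y /andP[y_gt0 leyt]; apply/eqP => Py.
have : (ppoly R c b D.-1).[Num.sqrt y] = 0.
  by rewrite ppoly_horner sqr_sqrtr ?ltW // DE /= Py mulr0.
case/root_ppoly_theta => j lejD sE.
have s_gt0 : 0 < Num.sqrt y by rewrite sqrtr_gt0.
have lts : Num.sqrt y < theta d.
  rewrite -[theta d]ger0_norm ?ltW // -sqrtr_sqr.
  by rewrite ltr_sqrt ?(le_lt_trans leyt) // exprn_gt0.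
have [lejd|ltdj] := leqP j d.
  have := distinct_eigenvalues_le eig_e (i := j) (j := d) ltac:(lia).
  by rewrite -sE leNgt lts.
have := distinct_eigenvalues_le eig_e (i := d.+1) (j := j) ltac:(lia).
by rewrite -sE opp_d; lra.
Qed.

End NonVanishing.

Theorem theorem7p5 (R : realType) (V : finType) (e : rel V)
    (c b : nat -> nat) (D : nat) (theta : nat -> R) (t : R)
    (drg_e : distance_regular e c b)
    (bip_e : bipartite_graph e)
    (diam_e : diameter e = D)
    (D_ge4 : (4 <= D)%N)
    (eig_e : distinct_eigenvalues e D theta)
    (t_odd : odd D -> theta 1%N ^+ 2 < t \/ t < theta (D./2) ^+ 2)
    (t_even : ~~ odd D -> theta 1%N ^+ 2 < t \/ t <= 0) :
  [/\ forall i : nat, (i <= D - 1)%N -> (Ppoly R c b i).[t] != 0,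
      gpoly c b D t 0 = 1 &
      forall i : nat, (i <= D - 2)%N ->
        'X * gpoly c b D t i =
        (c i.+1)%:R *: gpoly c b D t i.+1 +
        omega c b t i *: (if i is j.+1 then gpoly c b D t j else 0)].
Proof.
have D_gt0 : (0 < D)%N by lia.
have cb := drg_bipartite_array drg_e bip_e diam_e D_gt0.
have P_neq0 i : (i < D)%N -> (Ppoly R c b i).[t] != 0.
  move=> ltiD; have large := Ppoly_neq0_large drg_e bip_e diam_e D_gt0 eig_e ltiD.
  case oddD: (odd D).
    have [] := t_odd oddD; first exact: large.
    exact: (Ppoly_neq0_small drg_e bip_e diam_e D_gt0 eig_e).
  have [] := t_even (negbT oddD); first exact: large.
  exact: (Ppoly_neq0_nonpos drg_e bip_e diam_e D_gt0).
split=> [i lei||i lei].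
- by apply: P_neq0; lia.
- by apply: (gpoly0 cb); lia.
- by apply: (gpoly_rec cb P_neq0); lia.
Qed.
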